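(* Let $(L_1,\cdot_1,[\;,\;]_1)$ and $(L_2,\cdot_2,[\;,\;]_2)$ be two transposed Poisson algebras. Define two bilinear operations $\cdot$ and $[\;,\;]$ on $L_1\otimes L_2$ by $$(x_1\otimes x_2)\cdot(y_1\otimes y_2)=x_1\cdot_1 y_1\otimes x_2\cdot_2 y_2,$$ $$[x_1\otimes x_2,y_1\otimes y_2]=[x_1,y_1]_1\otimes x_2\cdot_2 y_2+x_1\cdot_1 y_1\otimes[x_2,y_2]_2,$$ for all $x_1,y_1\in L_1$, $x_2,y_2\in L_2$. Then $(L_1\otimes L_2,\cdot,[\;,\;])$ is a transposed Poisson algebra.
   Context: All vector spaces and tensor products are over a field $K$ of characteristic zero. Commutative associative algebras are not assumed unital. A transposed Poisson algebra is a triple $(L,\cdot,[\;,\;])$ where $L$ is a vector space, $\cdot,[\;,\;]:L\otimes L\to L$ are bilinear operations, $(L,\cdot)$ is a commutative associative algebra, $(L,[\;,\;])$ is a Lie algebra, and $2z\cdot[x,y]=[z\cdot x,y]+[x,z\cdot y]$ for all $x,y,z\in L$. *)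

(* Defs.v *)
From HB Require Import structures.
From mathcomp Require Import all_boot all_algebra.
From mathcomp Require Import sesquilinear ring_quotient generic_quotient.
From mathcomp Require Import boolp freeg.

Set Implicit Arguments.
Unset Strict Implicit.
Unset Printing Implicit Defensive.

Import GRing.Theory.

Local Open Scope ring_scope.
Local Open Scope quotient_scope.

(* The tensor product of two vector spaces is the free vector space on the set
   L1 * L2 modulo the subspace spanned by the bilinearity relators; its
   universal property is tensor_liftE together with tensor_linear_ext. *)
Section Tensor.
Variables (K : fieldType) (L1 L2 : lmodType K).

Local Notation free := {freeg (L1 * L2)%type / K}.

Definition free_pair (x : L1) (y : L2) : free := << (x, y) >>.

Inductive tensor_rel : free -> Prop :=
| TensorRelL (a : K) (x x' : L1) (y : L2) :
    tensor_rel
      (free_pair (a *: x + x') y - (a *: free_pair x y + free_pair x' y))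
| TensorRelR (a : K) (x : L1) (y y' : L2) :
    tensor_rel
      (free_pair x (a *: y + y') - (a *: free_pair x y + free_pair x y'))
| TensorRel0 : tensor_rel 0
| TensorRelZD (a : K) u v :
    tensor_rel u -> tensor_rel v -> tensor_rel (a *: u + v).

Definition tensor_relb : {pred free} := fun u => `[< tensor_rel u >].

Lemma tensor_relP u : reflect (tensor_rel u) (u \in tensor_relb).
Proof. exact: asboolP. Qed.

Lemma tensor_relb_submod : submod_closed tensor_relb.
Proof.
split; first exact/tensor_relP/TensorRel0.
by move=> a u v /tensor_relP Ru /tensor_relP Rv; apply/tensor_relP/TensorRelZD.
Qed.

HB.instance Definition _ :=
  GRing.isSubmodClosed.Build K free tensor_relb tensor_relb_submod.

Definition tensor : Type := Quotient.quot (tensor_relb : zmodClosed _).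

HB.instance Definition _ := ZmodQuotient.on tensor.

Definition tensor_pi : free -> tensor :=
  @pi free (Quotient.quot (tensor_relb : zmodClosed _)).

Definition tensor_repr : tensor -> free :=
  @repr free (Quotient.quot (tensor_relb : zmodClosed _)).

Lemma tensor_reprK : cancel tensor_repr tensor_pi.
Proof. exact: reprK. Qed.

Lemma tensor_piE (u v : free) : tensor_pi u = tensor_pi v <-> tensor_rel (u - v).
Proof.
split=> [/eqP|Ruv]; first by rewrite -Quotient.idealrBE => /tensor_relP.
by apply/eqP; rewrite -Quotient.idealrBE; apply/tensor_relP.
Qed.

Lemma tensor_pi_is_zmod_morphism : zmod_morphism tensor_pi.
Proof. exact: pi_is_zmod_morphism. Qed.

HB.instance Definition _ :=
  GRing.isZmodMorphism.Build free tensor tensor_pi tensor_pi_is_zmod_morphism.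

Definition tensor_scale (a : K) (t : tensor) : tensor :=
  tensor_pi (a *: tensor_repr t).

Lemma tensor_pi_scale a u : tensor_scale a (tensor_pi u) = tensor_pi (a *: u).
Proof.
apply/tensor_piE; rewrite -scalerBr -[_ *: _]addr0.
by apply/TensorRelZD/TensorRel0/tensor_piE; rewrite tensor_reprK.
Qed.

Lemma tensor_scaleA a b t :
  tensor_scale a (tensor_scale b t) = tensor_scale (a * b) t.
Proof. by rewrite -[t]tensor_reprK !tensor_pi_scale scalerA. Qed.

Lemma tensor_scale1 : left_id 1 tensor_scale.
Proof. by move=> t; rewrite -[t]tensor_reprK tensor_pi_scale scale1r. Qed.

Lemma tensor_scaleDr : right_distributive tensor_scale +%R.
Proof.
move=> a t t'; rewrite -[t]tensor_reprK -[t']tensor_reprK.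
by rewrite -raddfD !tensor_pi_scale scalerDr raddfD.
Qed.

Lemma tensor_scaleDl t : {morph tensor_scale^~ t : a b / a + b}.
Proof.
move=> a b; rewrite -[t]tensor_reprK.
by rewrite !tensor_pi_scale scalerDl raddfD.
Qed.

HB.instance Definition _ := GRing.Zmodule_isLmodule.Build K tensor
  tensor_scaleA tensor_scale1 tensor_scaleDr tensor_scaleDl.

Lemma tensor_pi_is_scalable : scalable tensor_pi.
Proof. by move=> a u; rewrite -tensor_pi_scale. Qed.

HB.instance Definition _ :=
  GRing.isScalable.Build K free tensor *:%R tensor_pi tensor_pi_is_scalable.

Definition tens (x : L1) (y : L2) : tensor := tensor_pi (free_pair x y).

Lemma tens_is_bilinear : bilinear_for *:%R *:%R tens.
Proof.
by split=> [y a x x' | x a y y']; rewrite /tens -linearP; apply/tensor_piE;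
  constructor.
Qed.

HB.instance Definition _ :=
  bilinear_isBilinear.Build K L1 L2 tensor *:%R *:%R tens tens_is_bilinear.

Lemma tensor_ind (P : tensor -> Prop) :
    P 0 -> (forall a x y t, P t -> P (a *: tens x y + t)) -> forall t, P t.
Proof.
move=> P0 PD t; rewrite -[t]tensor_reprK; set u := tensor_repr t; rewrite -[u]freeg_sumE.
elim: (dom u) => [|[x y] s IHs]; first by rewrite big_nil raddf0.
rewrite big_cons raddfD /=.
have -> : << coeff (x, y) u *g (x, y) >> = coeff (x, y) u *: free_pair x y.
  by apply/eqP/freeg_eqP=> k; rewrite coeffZ !coeffU mul1r.
by rewrite linearZ; apply: PD.
Qed.

Lemma tensor_linear_ext (W : lmodType K) (f g : {linear tensor -> W}) :
  (forall x y, f (tens x y) = g (tens x y)) -> f =1 g.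
Proof.
move=> fg; apply: tensor_ind => [|a x y t IHt]; first by rewrite !raddf0.
by rewrite !linearP fg IHt.
Qed.

Section Lift.
Variables (W : lmodType K) (f : {bilinear L1 -> L2 -> W}).

Let flift : free -> W := fglift (fun p => f p.1 p.2).

Let flift_pair x y : flift (free_pair x y) = f x y.
Proof. by rewrite /flift liftU scale1r. Qed.

Let flift_linear : linear flift.
Proof.
have fB : {morph flift : u v / u - v} by exact: lift_is_additive.
have f0 : flift 0 = 0 by rewrite -[0 in LHS](subrr 0) fB subrr.
have fD : {morph flift : u v / u + v}.
  by move=> u v; rewrite -[v in LHS]opprK -[- v]sub0r !fB f0 sub0r opprK.
move=> a u v; rewrite fD; congr (_ + _).
rewrite -[u]freeg_sumE.
elim: (dom u) => [|p s IHs]; first by rewrite big_nil scaler0 f0 scaler0.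
rewrite big_cons scalerDr !fD scalerDr IHs; congr (_ + _).
have -> : a *: << coeff p u *g p >> = << a * coeff p u *g p >>.
  by apply/eqP/freeg_eqP=> k; rewrite coeffZ !coeffU mulrA.
by rewrite /flift !liftU scalerA.
Qed.

HB.instance Definition _ :=
  GRing.isLinear.Build K free W *:%R flift flift_linear.

Let flift_rel u : tensor_rel u -> flift u = 0.
Proof.
elim=> [a x x' y|a x y y'||a v w _ fv _ fw]; last 1 first.
- by rewrite linearP /= fv fw scaler0 addr0.
- by rewrite linearB linearP /= !flift_pair linearPl subrr.
- by rewrite linearB linearP /= !flift_pair linearPr subrr.
- exact: linear0.
Qed.

Definition tensor_lift : tensor -> W := fun t => flift (tensor_repr t).

Let tensor_pi_lift u : tensor_lift (tensor_pi u) = flift u.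
Proof.
apply/subr0_eq; rewrite -linearB; apply/flift_rel/tensor_piE.
by rewrite tensor_reprK.
Qed.

Lemma tensor_lift_is_linear : linear tensor_lift.
Proof.
move=> a t t'; rewrite -[t]tensor_reprK -[t']tensor_reprK.
by rewrite -linearP !tensor_pi_lift linearP.
Qed.

HB.instance Definition _ :=
  GRing.isLinear.Build K tensor W *:%R tensor_lift tensor_lift_is_linear.

Lemma tensor_liftE x y : tensor_lift (tens x y) = f x y.
Proof. by rewrite tensor_pi_lift flift_pair. Qed.

End Lift.
End Tensor.

Notation "x \ot y" := (tens x y) (at level 39, left associativity) : ring_scope.

(* The associative algebra (L, mul) need not be unital, whence a predicate on
   bilinear operations rather than the library's (unital) ring structures. *)
Record transposed_poisson (K : fieldType) (L : lmodType K)
    (mul br : {bilinear L -> L -> L}) : Prop := TransposedPoisson {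
  tp_mulC : commutative mul;
  tp_mulA : associative mul;
  tp_br_alt : forall x, br x x = 0;
  tp_jacobi : forall x y z, br x (br y z) + br y (br z x) + br z (br x y) = 0;
  tp_compat : forall x y z, mul z (br x y) *+ 2 = br (mul z x) y + br x (mul z y)
}.

(* Main.v *)
Require Import Defs.
From HB Require Import structures.
From mathcomp Require Import all_boot all_algebra sesquilinear.

Import GRing.Theory.
Local Open Scope ring_scope.

(** A bilinear operation on a tensor product is determined by its values on
    pure tensors, and the tensor product [tensor_bilin f g] of two bilinear maps
    exists by lifting twice along the universal property; this gives both
    operations and their uniqueness.  Each axiom of a transposed Poisson algebra
    is multilinear (the alternating law being traded for antisymmetry, as 2 is
    invertible), so it need only be checked on pure tensors, where all axioms
    but the Jacobi identity are immediate.

    For the latter, put A = [x, yz], B = [y, zx], C = [z, xy], and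
    a = x[y, z], b = y[z, x], c = z[x, y].  In any transposed Poisson algebra,
    2a = B - C, 2b = C - A and 2c = A - B ([tp_compat_diff]).  Expanding the
    cyclic sum on pure tensors, the double brackets cancel by the Jacobi
    identities of the two factors, and there remains
    a (x) A' + b (x) B' + c (x) C' + A (x) a' + B (x) b' + C (x) c',
    with primes for the second factor.  Twice this sum is
    (B - C) (x) A' + (C - A) (x) B' + (A - B) (x) C'
    + A (x) (B' - C') + B (x) (C' - A') + C (x) (A' - B') = 0
    ([tens_cyclic_cancel]). *)

(** * Bilinear maps on tensor products *)

Section TensorBilinear.
Context {K : fieldType}.

(** Linear maps agreeing on pure tensors are equal; here linearity is a
    hypothesis, so that the lemma applies to composite expressions. *)
Lemma tensor_ext {U1 U2 W : lmodType K} (f g : tensor U1 U2 -> W) :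
    linear f -> linear g -> (forall x y, f (x \ot y) = g (x \ot y)) ->
  f =1 g.
Proof.
move=> fL gL fg.
have lin0 (h : tensor U1 U2 -> W) : linear h -> h 0 = 0.
  by move=> /(_ (-1) 0 0); rewrite !scaleN1r !addNr.
apply: tensor_ind => [|a x y t IHt]; first by rewrite !lin0.
by rewrite fL gL fg IHt.
Qed.

Lemma tensor_bilinear_ext {U1 U2 V1 V2 W : lmodType K}
    (f g : {bilinear tensor U1 U2 -> tensor V1 V2 -> W}) :
    (forall x1 x2 y1 y2,
      f (x1 \ot x2) (y1 \ot y2) = g (x1 \ot x2) (y1 \ot y2)) ->
  f =2 g.
Proof.
move=> fg x y; move: x; apply: tensor_ext => [||x1 x2]; try exact: linearPl.
by move: y; apply: tensor_ext => [||y1 y2]; try exact: linearPr.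
Qed.

Section Product.
Context {U1 U2 V1 V2 W1 W2 : lmodType K}.
Variables (f : {bilinear U1 -> V1 -> W1}) (g : {bilinear U2 -> V2 -> W2}).

Let pure (y1 : V1) (y2 : V2) (x1 : U1) (x2 : U2) : tensor W1 W2 :=
  f x1 y1 \ot g x2 y2.

Let pure_bilinear y1 y2 : bilinear_for *:%R *:%R (pure y1 y2).
Proof.
by split=> [x2 a x x' | x1 a x x'];
  rewrite /pure ?linearPl /= ?linearPl ?linearPr.
Qed.

HB.instance Definition _ y1 y2 := bilinear_isBilinear.Build K U1 U2
  (tensor W1 W2) *:%R *:%R (pure y1 y2) (pure_bilinear y1 y2).

(* The lift in (x1, x2) alone, still a function of the pair (y1, y2). *)
Let half (x : tensor U1 U2) (y1 : V1) (y2 : V2) : tensor W1 W2 :=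
  tensor_lift (pure y1 y2) x.

Let half_linear y1 y2 : linear (half^~ y1 ^~ y2).
Proof. by move=> a x x'; rewrite /half linearP. Qed.

Let half_pure x1 x2 y1 y2 : half (x1 \ot x2) y1 y2 = f x1 y1 \ot g x2 y2.
Proof. exact: tensor_liftE. Qed.

Let linear_comb {U1' U2' W : lmodType K} a (h h' : tensor U1' U2' -> W) :
  linear h -> linear h' -> linear (fun x => a *: h x + h' x).
Proof.
move=> hL h'L b x x'; rewrite hL h'L !scalerDr !scalerA mulrC.
by rewrite addrACA.
Qed.

Let half_bilinear x : bilinear_for *:%R *:%R (half x).
Proof.
split=> [y2 a y y' | y1 a y y']; move: x; apply: tensor_ext => [||x1 x2];
  try (exact: half_linear); try (by apply: linear_comb; exact: half_linear).
- by rewrite /= !half_pure linearPr linearPl.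
- by rewrite /= !half_pure linearPr linearPr.
Qed.

HB.instance Definition _ x := bilinear_isBilinear.Build K V1 V2
  (tensor W1 W2) *:%R *:%R (half x) (half_bilinear x).

(** The bilinear map sending (x1 (x) x2, y1 (x) y2) to f x1 y1 (x) g x2 y2,
    obtained by lifting first in (x1, x2), then in (y1, y2). *)
Definition tensor_bilin (x : tensor U1 U2) (y : tensor V1 V2) : tensor W1 W2 :=
  tensor_lift (half x) y.

Lemma tensor_bilinE x1 x2 y1 y2 :
  tensor_bilin (x1 \ot x2) (y1 \ot y2) = f x1 y1 \ot g x2 y2.
Proof. by rewrite /tensor_bilin tensor_liftE /= half_pure. Qed.

Lemma tensor_bilin_is_bilinear : bilinear_for *:%R *:%R tensor_bilin.
Proof.
split=> [y a x x' | x a y y']; last by rewrite /tensor_bilin linearP.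
have binL z : linear (tensor_bilin z).
  by move=> b t t'; rewrite /tensor_bilin linearP.
move: y; apply: tensor_ext => [||y1 y2]; first exact: binL.
  by apply: linear_comb; exact: binL.
by rewrite /tensor_bilin !tensor_liftE /= half_linear.
Qed.

HB.instance Definition _ := bilinear_isBilinear.Build K (tensor U1 U2)
  (tensor V1 V2) (tensor W1 W2) *:%R *:%R tensor_bilin tensor_bilin_is_bilinear.

End Product.

Section Sum.
Context {U V W : lmodType K}.
Variables f g : {bilinear U -> V -> W}.

(** The pointwise sum of two bilinear maps. *)
Definition bilin_add (x : U) (y : V) : W := f x y + g x y.

Lemma bilin_add_is_bilinear : bilinear_for *:%R *:%R bilin_add.
Proof.
by split=> [z a x x' | z a x x'];
  rewrite /bilin_add ?linearPl ?linearPr /= scalerDr addrACA.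
Qed.

HB.instance Definition _ := bilinear_isBilinear.Build K U V W *:%R *:%R
  bilin_add bilin_add_is_bilinear.

End Sum.

End TensorBilinear.

(** * Transposed Poisson algebras *)

Lemma pchar0_mulr2n_eq0 {K : fieldType} (charK : [pchar K] =i pred0)
  {V : lmodType K} (v : V) : v *+ 2 = 0 -> v = 0.
Proof.
have two_neq0 : 2%:R != 0 :> K by have := charK 2; rewrite !inE /= => ->.
by rewrite -scaler_nat => /eqP; rewrite scaler_eq0 (negPf two_neq0) => /eqP.
Qed.

Section TransposedPoisson.
Context {K : fieldType} {L : lmodType K} {mul br : {bilinear L -> L -> L}}.
Hypothesis tp : transposed_poisson mul br.

Lemma tp_brC x y : br x y = - br y x.
Proof.
apply/eqP; rewrite -addr_eq0; apply/eqP.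
have := tp_br_alt tp (x + y).
by rewrite linearDl !linearDr !(tp_br_alt tp) /= add0r addr0.
Qed.

Lemma tp_mul_rot x y z : mul y (mul z x) = mul x (mul y z).
Proof. by rewrite (tp_mulA tp) (tp_mulC tp). Qed.

(** The compatibility axiom with its right-hand side written cyclically: in the
    notation of the introduction, 2a = B - C, and its rotations. *)
Lemma tp_compat_diff x y z :
  mul x (br y z) *+ 2 = br y (mul z x) - br z (mul x y).
Proof. by rewrite (tp_compat tp) addrC (tp_brC (mul x y)) (tp_mulC tp x z). Qed.

End TransposedPoisson.

(** Twice the sum of the mixed terms of the Jacobi identity, in the notation of
    the introduction: each difference expands into pure tensors that occur once
    with each sign. *)
Lemma tens_cyclic_cancel {K : fieldType} {L1 L2 : lmodType K}
    (A B C : L1) (A' B' C' : L2) :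
  (B - C) \ot A' + (C - A) \ot B' + (A - B) \ot C'
  + (A \ot (B' - C') + B \ot (C' - A') + C \ot (A' - B')) = 0.
Proof.
rewrite !linearBl !linearBr /=; apply/eqP; rewrite addr_eq0; apply/eqP.
have cycD (V : zmodType) (p q r p' q' r' : V) :
  p - p' + (q - q') + (r - r') = (p + q + r) - (p' + q' + r').
  by rewrite (addrACA p) -opprD [LHS]addrACA -opprD.
rewrite !cycD opprB; congr (_ - _).
  by rewrite addrC addrA.
by rewrite -addrA addrC.
Qed.

(** * The tensor product of two transposed Poisson algebras *)

Section TensorTransposedPoisson.
Context {K : fieldType} (charK : [pchar K] =i pred0) {L1 L2 : lmodType K}.
Context {mul1 br1 : {bilinear L1 -> L1 -> L1}}.
Context {mul2 br2 : {bilinear L2 -> L2 -> L2}}.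
Hypothesis (tp1 : transposed_poisson mul1 br1).
Hypothesis (tp2 : transposed_poisson mul2 br2).

Local Notation L := (tensor L1 L2).

Context {mul br : {bilinear L -> L -> L}}.
Hypothesis mulE : forall x1 y1 x2 y2,
  mul (x1 \ot x2) (y1 \ot y2) = mul1 x1 y1 \ot mul2 x2 y2.
Hypothesis brE : forall x1 y1 x2 y2,
  br (x1 \ot x2) (y1 \ot y2) =
    br1 x1 y1 \ot mul2 x2 y2 + mul1 x1 y1 \ot br2 x2 y2.

Let mulC : commutative mul.
Proof.
move=> x y; move: x; apply: tensor_ext => [||x1 x2];
  [exact: linearPl | exact: linearPr |].
move: y; apply: tensor_ext => [||y1 y2]; [exact: linearPr | exact: linearPl |].
by rewrite !mulE (tp_mulC tp1) (tp_mulC tp2).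
Qed.

Let mulA : associative mul.
Proof.
move=> x y z; move: x; apply: tensor_ext => [a s t|a s t|x1 x2];
  rewrite ?linearPl //= ?linearPl //.
move: y; apply: tensor_ext => [a s t|a s t|y1 y2];
  rewrite ?linearPl //= ?linearPr //= ?linearPl //.
move: z; apply: tensor_ext => [a s t|a s t|z1 z2];
  rewrite ?linearPr //= ?linearPr //.
by rewrite !mulE (tp_mulA tp1) (tp_mulA tp2).
Qed.

Let brC x y : br x y = - br y x.
Proof.
move: x; apply: tensor_ext => [a s t|a s t|x1 x2].
- exact: linearPl.
- by rewrite linearPr opprD scalerN.
move: y; apply: tensor_ext => [a s t|a s t|y1 y2].
- exact: linearPr.
- by rewrite linearPl opprD scalerN.
rewrite !brE (tp_mulC tp1 y1) (tp_mulC tp2 y2) (tp_brC tp1 y1) (tp_brC tp2 y2).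
by rewrite linearNl linearNr /= opprD !opprK.
Qed.

(* The alternating law is quadratic, hence does not reduce to pure tensors
   directly; it follows from antisymmetry by halving. *)
Let br_alt x : br x x = 0.
Proof.
by apply: (pchar0_mulr2n_eq0 charK); rewrite mulr2n {2}brC subrr.
Qed.

Let compat x y z : mul z (br x y) *+ 2 = br (mul z x) y + br x (mul z y).
Proof.
move: x; apply: tensor_ext => [a s t|a s t|x1 x2].
- by rewrite linearPl /= linearPr /= mulrnDl scalerMnr.
- by rewrite linearPr /= !linearPl /= scalerDr addrACA.
move: y; apply: tensor_ext => [a s t|a s t|y1 y2].
- by rewrite !linearPr /= mulrnDl scalerMnr.
- by rewrite !linearPr /= scalerDr addrACA.
move: z; apply: tensor_ext => [a s t|a s t|z1 z2].
- by rewrite linearPl /= mulrnDl scalerMnr.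
- by rewrite !linearPl /= linearPr /= scalerDr addrACA.
rewrite brE linearDr /= !mulE !brE mulrnDl.
rewrite -[X in X + _ = _]linearMnl -[X in _ + X = _]linearMnr /=.
rewrite (tp_compat tp1) (tp_compat tp2).
rewrite linearDl linearDr /= [RHS]addrACA.
rewrite !(tp_mulA tp1) !(tp_mulA tp2).
by rewrite (tp_mulC tp1 x1) (tp_mulC tp2 x2).
Qed.

(* The cyclic sum of double brackets.  As it is invariant under cyclic
   rotation, linearity in the first argument gives trilinearity. *)
Let jacobiator x y z := br x (br y z) + br y (br z x) + br z (br x y).

Let jacobiator_cycle x y z : jacobiator x y z = jacobiator y z x.
Proof. by rewrite /jacobiator -addrA addrC. Qed.

Let jacobiator_linear y z : linear (jacobiator^~ y ^~ z).
Proof.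
move=> a s t; rewrite /jacobiator !(linearPl, linearPr) /=.
by rewrite !scalerDr (addrACA (a *: _)) [LHS]addrACA.
Qed.

Let zero_linear : linear (fun _ : L => 0 : L).
Proof. by move=> a s t; rewrite scaler0 addr0. Qed.

Let br_brE x1 x2 y1 y2 z1 z2 :
  br (x1 \ot x2) (br (y1 \ot y2) (z1 \ot z2)) =
    br1 x1 (br1 y1 z1) \ot mul2 x2 (mul2 y2 z2)
    + mul1 x1 (mul1 y1 z1) \ot br2 x2 (br2 y2 z2)
    + (mul1 x1 (br1 y1 z1) \ot br2 x2 (mul2 y2 z2)
       + br1 x1 (mul1 y1 z1) \ot mul2 x2 (br2 y2 z2)).
Proof.
rewrite brE linearDr /= !brE [X in _ + X]addrC.
exact: addrACA.
Qed.

Let jacobiator_pure x1 x2 y1 y2 z1 z2 :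
  jacobiator (x1 \ot x2) (y1 \ot y2) (z1 \ot z2) = 0.
Proof.
have sumD3 (V : zmodType) (p m q n r o : V) :
  p + m + (q + n) + (r + o) = p + q + r + (m + n + o).
  by rewrite (addrACA p) [LHS]addrACA.
have tens_sumDl u v w (t : L2) :
  u \ot t + v \ot t + w \ot t = (u + v + w) \ot t.
  by rewrite !linearDl.
have tens_sumDr (t : L1) u v w :
  t \ot u + t \ot v + t \ot w = t \ot (u + v + w).
  by rewrite !linearDr.
have tensMnl (u : L1) (v : L2) : (u \ot v) *+ 2 = (u *+ 2) \ot v.
  by rewrite linearMnl.
have tensMnr (u : L1) (v : L2) : (u \ot v) *+ 2 = u \ot (v *+ 2).
  by rewrite linearMnr.
rewrite /jacobiator !br_brE sumD3 [X in X + _ = 0]sumD3 [X in _ + X = 0]sumD3.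
(* The terms with a double bracket vanish by the two Jacobi identities. *)
rewrite (tp_mul_rot tp1 y1 z1 x1) (tp_mul_rot tp1 x1 y1 z1).
rewrite (tp_mul_rot tp2 y2 z2 x2) (tp_mul_rot tp2 x2 y2 z2).
rewrite tens_sumDl tens_sumDr (tp_jacobi tp1) (tp_jacobi tp2).
rewrite linear0l linear0r !add0r.
(* The mixed terms cancel after doubling. *)
apply: (pchar0_mulr2n_eq0 charK).
rewrite !mulrnDl [X in X + _ + _ + _]tensMnl [X in _ + X + _ + _]tensMnl.
rewrite [X in _ + X + _]tensMnl !tensMnr.
rewrite !(tp_compat_diff tp1) !(tp_compat_diff tp2).
exact: tens_cyclic_cancel.
Qed.

Let jacobi x y z : jacobiator x y z = 0.
Proof.
move: x; apply: tensor_ext => [||x1 x2] //.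
rewrite jacobiator_cycle.
move: y; apply: tensor_ext => [||y1 y2] //.
rewrite jacobiator_cycle.
by move: z; apply: tensor_ext => [||z1 z2].
Qed.

(** Any bilinear operations with the prescribed values on pure tensors satisfy
    the axioms. *)
Lemma tensor_transposed_poisson : transposed_poisson mul br.
Proof. by split. Qed.

End TensorTransposedPoisson.

Theorem theorem2p8 (K : fieldType) (charK : [pchar K] =i pred0)
    (L1 L2 : lmodType K)
    (mul1 br1 : {bilinear L1 -> L1 -> L1})
    (mul2 br2 : {bilinear L2 -> L2 -> L2})
    (tp1 : transposed_poisson mul1 br1) (tp2 : transposed_poisson mul2 br2) :
  let L : lmodType K := tensor L1 L2 in
  let mul_formula (mul : {bilinear L -> L -> L}) :=
    forall x1 y1 x2 y2,
      mul (x1 \ot x2) (y1 \ot y2) = mul1 x1 y1 \ot mul2 x2 y2 in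
  let br_formula (br : {bilinear L -> L -> L}) :=
    forall x1 y1 x2 y2,
      br (x1 \ot x2) (y1 \ot y2) =
        br1 x1 y1 \ot mul2 x2 y2 + mul1 x1 y1 \ot br2 x2 y2 in
  exists mul br : {bilinear L -> L -> L},
    [/\ mul_formula mul, br_formula br,
        forall mul', mul_formula mul' -> mul' =2 mul,
        forall br', br_formula br' -> br' =2 br
      & transposed_poisson mul br].
Proof.
move=> L mul_formula br_formula.
have mulP : mul_formula (tensor_bilin mul1 mul2).
  by move=> x1 y1 x2 y2; exact: tensor_bilinE.
have brP : br_formula
    (bilin_add (tensor_bilin br1 mul2) (tensor_bilin mul1 br2)).
  by move=> x1 y1 x2 y2; rewrite /= /bilin_add /= !tensor_bilinE.
exists (tensor_bilin mul1 mul2).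
exists (bilin_add (tensor_bilin br1 mul2) (tensor_bilin mul1 br2)).
split=> // [mul' mul'P | br' br'P |]; last first.
- exact: (tensor_transposed_poisson charK tp1 tp2 mulP brP).
- by apply: tensor_bilinear_ext => x1 x2 y1 y2; rewrite br'P brP.
- by apply: tensor_bilinear_ext => x1 x2 y1 y2; rewrite mul'P mulP.
Qed.
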